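(* Fix $J\ge2$, $\alpha\in(0,1)$, $\Theta\ge1$, $\pi,b_T,b_C\in(0,1)$ and $\eta_T,\eta_C\in(0,1]$, and let data be generated by the process described in the context. Put $$\tilde\Gamma_b=\frac{b_T/(1-b_T)}{b_C/(1-b_C)},\qquad \tilde\Gamma_n=\frac{b_T/(1-b_T)}{b_C/(1-b_C)}\times\frac{\eta_T/\eta_C}{\Theta}.$$ Then $\tilde\Gamma_b$ is the design sensitivity of the broad case test and $\tilde\Gamma_n$ is the design sensitivity of the narrow case test with the given $\Theta$; that is, for $\Gamma\ge1$, as $I\to\infty$: (i) the probability that the level-$\alpha$ broad case test with parameter $\Gamma$ rejects tends to $1$ if $\Gamma<\tilde\Gamma_b$ and to $0$ if $\Gamma>\tilde\Gamma_b$; (ii) the probability that the level-$\alpha$ narrow case test with parameters $(\Gamma,\Theta)$ rejects tends to $1$ if $\Gamma<\tilde\Gamma_n$ and to $0$ if $\Gamma>\tilde\Gamma_n$.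
   Context: Data generating process. There are $I$ matched sets of $J$ subjects. The first subject of each set is a broad case and the other $J-1$ subjects are referents (not broad cases). All subjects are independent. Each subject has a treatment indicator $Z_{ij}\in\{0,1\}$ with $$\Pr(Z_{i1}=1)=\frac{b_T\pi}{b_T\pi+b_C(1-\pi)},\qquad \Pr(Z_{ij}=1)=\frac{(1-b_T)\pi}{(1-b_T)\pi+(1-b_C)(1-\pi)}\quad (j=2,\dots,J).$$ Given $Z_{i1}$, the broad case $i1$ is a narrow case with probability $\eta_T$ if $Z_{i1}=1$ and $\eta_C$ if $Z_{i1}=0$; referents are never narrow cases. (This is the law of i.i.d. subjects with $\Pr(Z=1)=\pi$, probability of being a broad case $b_T$ or $b_C$ given $Z=1$ or $Z=0$, and probability of being a narrow case given being a broad case $\eta_T$ or $\eta_C$ given $Z=1$ or $Z=0$, conditional on each set consisting of one broad case, listed first, and $J-1$ referents.) Tests. Let $Y_i=Z_{i1}$, $m_i=\sum_{j=1}^J Z_{ij}$, and let $\mathcal N$ be the (random) set of indices $i$ for which the broad case $i1$ is a narrow case. Let $Y_b=\sum_{i=1}^I Y_i$, $Y_n=\sum_{i\in\mathcal N}Y_i$, $$\bar{\bar p}_{bi}=\frac{m_i\Gamma}{m_i\Gamma+J-m_i},\qquad \bar{\bar p}_{ni}=\frac{m_i\Theta\Gamma}{m_i\Theta\Gamma+J-m_i}.$$ With $\Phi$ the standard normal distribution function, the level-$\alpha$ broad case test with parameter $\Gamma$ rejects if $$Y_b\ge\sum_{i=1}^I\bar{\bar p}_{bi}+\Phi^{-1}(1-\alpha)\Big\{\sum_{i=1}^I\bar{\bar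 p}_{bi}(1-\bar{\bar p}_{bi})\Big\}^{1/2},$$ and the level-$\alpha$ narrow case test with parameters $(\Gamma,\Theta)$ rejects if $$Y_n\ge\sum_{i\in\mathcal N}\bar{\bar p}_{ni}+\Phi^{-1}(1-\alpha)\Big\{\sum_{i\in\mathcal N}\bar{\bar p}_{ni}(1-\bar{\bar p}_{ni})\Big\}^{1/2}.$$ *)

(* Defs.v *)
From mathcomp Require Import all_boot all_order all_algebra finmap.
From mathcomp Require Import all_classical all_reals all_analysis.

Set Implicit Arguments.
Unset Strict Implicit.
Unset Printing Implicit Defensive.

Import Order.TTheory GRing.Theory Num.Theory.
Import numFieldNormedType.Exports.

Local Open Scope classical_set_scope.
Local Open Scope ring_scope.

Definition Phi (R : realType) (x : R) : R :=
  fine (normal_prob (0 : R) 1 `]-oo, x]).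

(* The quantile function. [Phi] is a continuous increasing bijection from the
   line to ]0, 1[, so that for 0 < q < 1 this is the z such that Phi z = q. *)
Definition Phi_inv (R : realType) (q : R) : R := inf [set x | q <= Phi x].

Definition cond_prob d (T : measurableType d) (R : realType)
    (P : probability T R) (A B : set T) : R :=
  fine (P (A `&` B)) / fine (P B).

(* Mutual independence of the family X k, k in D. *)
Definition mutually_independent d (T : measurableType d) (R : realType)
    (P : probability T R) (K : choiceType) (D : set K)
    d' (V : measurableType d') (X : K -> T -> V) : Prop :=
  forall (F : {fset K}) (A : K -> set V),
    [set` F] `<=` D -> (forall k, measurable (A k)) ->
    P (\bigcap_(k in [set` F]) X k @^-1` A k)
    = (\prod_(k <- F) P (X k @^-1` A k))%E.

(* Sets and subjects are numbered from 0: subject (i, j), with j < J, is the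
   (j+1)-st subject of the (i+1)-st set, and (i, 0) is the broad case of its
   set. [Z i j] is its treatment and [N i j] says that it is a narrow case. *)
Record case_referent_process d (T : measurableType d) (R : realType)
    (P : probability T R) (J : nat) (p bT bC etaT etaC : R)
    (Z N : nat -> nat -> {RV P >-> bool}) : Prop := {
  subjects_independent :
    mutually_independent P [set k : nat * nat | (k.2 < J)%N]
      (fun k w => (Z k.1 k.2 w, N k.1 k.2 w));
  case_treated : forall i,
    P [set w | Z i 0%N w] = (bT * p / (bT * p + bC * (1 - p)))%:E;
  referent_treated : forall i j, (0 < j < J)%N ->
    P [set w | Z i j w]
    = ((1 - bT) * p / ((1 - bT) * p + (1 - bC) * (1 - p)))%:E;
  treated_case_narrow : forall i,
    cond_prob P [set w | N i 0%N w] [set w | Z i 0%N w] = etaT;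
  control_case_narrow : forall i,
    cond_prob P [set w | N i 0%N w] [set w | ~~ Z i 0%N w] = etaC;
  referent_not_narrow : forall i j w, (0 < j < J)%N -> N i j w = false }.

Section Tests.
Variables (R : realType) (J : nat) (alpha : R).

(* z i j and n i j are the observed treatments and narrow case statuses. *)
Implicit Types z n : nat -> nat -> bool.

Definition nb_treated z (i : nat) : nat := (\sum_(j < J) z i j)%N.

Definition pbar (G : R) (m : nat) : R :=
  m%:R * G / (m%:R * G + J%:R - m%:R).

(* The test with odds bound G applied to the sets i < I such that A i. *)
Definition test_rejects (G : R) (I : nat) (A : pred nat) z : Prop :=
  \sum_(i < I | A i) (z i 0%N)%:R >=
    \sum_(i < I | A i) pbar G (nb_treated z i)
    + Phi_inv (1 - alpha)
      * Num.sqrt (\sum_(i < I | A i)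
          pbar G (nb_treated z i) * (1 - pbar G (nb_treated z i))).

Definition broad_test_rejects (Gamma : R) (I : nat) z : Prop :=
  test_rejects Gamma I xpredT z.

Definition narrow_test_rejects (Theta Gamma : R) (I : nat) z n : Prop :=
  test_rejects (Theta * Gamma) I (fun i => n i 0%N) z.

End Tests.

(* [power Gamma I] is the probability that a test with parameter Gamma rejects
   in a study of I matched sets. *)
Definition design_sensitivity (R : realType) (power : R -> nat -> \bar R)
    (Gamma0 : R) : Prop :=
  forall Gamma : R, 1 <= Gamma ->
    (Gamma < Gamma0 -> power Gamma I @[I --> \oo] --> 1%E) /\
    (Gamma0 < Gamma -> power Gamma I @[I --> \oo] --> 0%E).

(* Main.v *)
Require Import Defs.
From mathcomp Require Import all_boot all_order all_algebra.
From mathcomp Require Import perm finmap ring lra.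
From mathcomp Require Import all_classical all_reals all_analysis.

Set Implicit Arguments.
Unset Strict Implicit.
Unset Printing Implicit Defensive.

Import Order.TTheory GRing.Theory Num.Theory.
Import numFieldNormedType.Exports.

Local Open Scope classical_set_scope.
Local Open Scope ring_scope.

(** Both tests compare a sum of independent scores, [z_i - pbar_i] over the sets
    used by the test, with a threshold of order [sqrt I]. The scores are bounded
    and have a common mean, so by Chebyshev's inequality the sign of this mean
    decides whether the test rejects in the limit. A likelihood ratio makes the
    case exchangeable with its referents; averaging over the position of the
    case then shows that the mean score is a positive multiple of
    [a (1 - r) - b r G]. Here [a] and [b] are the probabilities that a set is
    used and its case is treated, respectively untreated, [r] is the probability
    that a referent is treated and [G] is the odds bound of the test: [Gamma]
    for the broad case test, [Theta * Gamma] for the narrow one. *)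

(** * Finite product laws: moments and Chebyshev's inequality *)

Section ProductLaw.
Variables (R : realFieldType) (I Y : finType) (u : I -> Y -> R).
Hypothesis u_ge0 : forall i y, 0 <= u i y.
Hypothesis u_sum1 : forall i, \sum_y u i y = 1.

(** Distributivity of product over sum. Taking [f] equal to 1 off one or two coordinates yields the
    marginal means below. *)
Lemma product_law_factor (f : I -> Y -> R) :
  \sum_(x : {ffun I -> Y}) \prod_i u i (x i) * \prod_i f i (x i)
  = \prod_i \sum_y u i y * f i y.
Proof.
by rewrite bigA_distr_bigA; apply: eq_bigr => x _; rewrite -big_split.
Qed.

Lemma product_law_mean1 (i : I) (g : Y -> R) :
  \sum_(x : {ffun I -> Y}) \prod_k u k (x k) * g (x i) = \sum_y u i y * g y.
Proof.
pose f k := if k == i then g else fun=> 1.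
transitivity (\sum_(x : {ffun I -> Y}) \prod_k u k (x k) * \prod_k f k (x k)).
  apply: eq_bigr => x _; congr (_ * _).
  rewrite (bigD1 i) //= /f eqxx big1 ?mulr1 // => k /negPf.
  by move=> ->.
rewrite product_law_factor (bigD1 i) //=.
rewrite [X in _ * X]big1 ?mulr1 => [|k /negPf ki].
  by rewrite /f eqxx.
by rewrite /f ki -[RHS](u_sum1 k); apply: eq_bigr => y _; rewrite mulr1.
Qed.

Lemma product_law_mean2 (i j : I) (g h : Y -> R) : i != j ->
  \sum_(x : {ffun I -> Y}) \prod_k u k (x k) * (g (x i) * h (x j))
  = (\sum_y u i y * g y) * (\sum_y u j y * h y).
Proof.
move=> ij.
pose f k := if k == i then g else if k == j then h else fun=> 1.
have ji : (j == i) = false by rewrite eq_sym (negPf ij).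
transitivity (\sum_(x : {ffun I -> Y}) \prod_k u k (x k) * \prod_k f k (x k)).
  apply: eq_bigr => x _; congr (_ * _).
  rewrite (bigD1 i) //= (bigD1 j) /= ?ji // /f eqxx ji eqxx mulrA.
  rewrite big1 ?mulr1 // => k /andP[/negPf ki /negPf kj].
  by rewrite ki kj.
rewrite product_law_factor (bigD1 i) //= (bigD1 j) /= ?ji // mulrA.
rewrite [X in _ * X]big1 ?mulr1 => [|k /andP[/negPf ki /negPf kj]].
  by rewrite /f eqxx ji eqxx.
by rewrite /f ki kj -[RHS](u_sum1 k); apply: eq_bigr => y _; rewrite mulr1.
Qed.

Variables (g : Y -> R) (mu : R).
Hypothesis g_le1 : forall y, `|g y| <= 1.
Hypothesis g_mean : forall i, \sum_y u i y * g y = mu.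

(** The centred scores [h] are pairwise uncorrelated, so only the diagonal of the squared sum
    survives, and each variance is at most 1. *)
Lemma product_law_second_moment :
  \sum_(x : {ffun I -> Y})
     \prod_i u i (x i) * (\sum_i g (x i) - #|I|%:R * mu) ^+ 2 <= #|I|%:R.
Proof.
pose h y := g y - mu.
have h_mean i : \sum_y u i y * h y = 0.
  under eq_bigr do rewrite mulrBr.
  by rewrite sumrB g_mean -mulr_suml u_sum1 mul1r subrr.
have h_sq i : \sum_y u i y * (h y * h y) <= 1.
  (* The variance is the second moment minus the squared mean, and [g] is bounded by 1. *)
  have -> : \sum_y u i y * (h y * h y) = \sum_y u i y * g y ^+ 2 - mu ^+ 2.
    transitivity (\sum_y (u i y * g y ^+ 2 - (2 * mu * (u i y * g y))
                          + u i y * mu ^+ 2)).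
      by apply: eq_bigr => y _; rewrite /h; ring.
    rewrite big_split /= sumrB -mulr_sumr g_mean -mulr_suml u_sum1; ring.
  rewrite lerBlDr (le_trans _ (_ : 1 <= _)) ?lerDl ?sqr_ge0 //.
  rewrite -(u_sum1 i); apply: ler_sum => y _.
  by rewrite ler_piMr // -real_normK ?num_real // expr_le1.
have expand (x : {ffun I -> Y}) :
    \prod_i u i (x i) * (\sum_i g (x i) - #|I|%:R * mu) ^+ 2
    = \sum_i \sum_j \prod_i u i (x i) * (h (x i) * h (x j)).
  have -> : \sum_i g (x i) - #|I|%:R * mu = \sum_i h (x i).
    by rewrite sumrB sumr_const -[mu *+ _]mulr_natl.
  rewrite expr2 mulr_suml mulr_sumr; apply: eq_bigr => i _.
  by rewrite !mulr_sumr.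
under eq_bigr do rewrite expand.
rewrite exchange_big /= -sum1_card natr_sum; apply: ler_sum => i _.
rewrite exchange_big /= (bigD1 i) //= [X in _ + X]big1 ?addr0 => [|j ji].
  by rewrite [leLHS](product_law_mean1 i (fun y => h y * h y)).
by rewrite product_law_mean2 1?eq_sym // h_mean mul0r.
Qed.

(** Markov's inequality for the squared deviation, which is at least [t ^+ 2] on the event. *)
Lemma product_law_chebyshev (t : R) : 0 < t ->
  \sum_(x : {ffun I -> Y} | t <= `|\sum_i g (x i) - #|I|%:R * mu|)
     \prod_i u i (x i) <= #|I|%:R / t ^+ 2.
Proof.
move=> t_gt0; rewrite ler_pdivlMr ?exprn_gt0 // mulr_suml.
apply: le_trans product_law_second_moment.
rewrite [leRHS](bigID (fun x : {ffun I -> Y} =>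
  t <= `|\sum_i g (x i) - #|I|%:R * mu|)) /=.
rewrite -[leLHS]addr0 lerD //; last first.
  by apply: sumr_ge0 => x _; rewrite mulr_ge0 ?sqr_ge0 ?prodr_ge0.
apply: ler_sum => x tx; rewrite ler_wpM2l ?prodr_ge0 //.
by rewrite -[leRHS]real_normK ?num_real // lerXn2r ?nnegrE // ltW.
Qed.

End ProductLaw.

(** * Exchangeability of independent identically distributed coordinates *)

Section Exchangeable.
Variables (R : comNzRingType) (J : finType) (rho : bool -> R).

(** Swapping the coordinates [j] and [k] preserves both the product weight and the total. *)
Lemma exchangeable_coordinate (f : nat -> R) (j k : J) :
  \sum_(z : {ffun J -> bool})
     (\prod_i rho (z i)) * f (\sum_i z i)%N * (z j)%:R
  = \sum_(z : {ffun J -> bool})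
     (\prod_i rho (z i)) * f (\sum_i z i)%N * (z k)%:R.
Proof.
pose s := fun z : {ffun J -> bool} => [ffun i => z (tperm j k i)].
have sK : involutive s.
  by move=> z; apply/ffunP => i; rewrite !ffunE tpermK.
rewrite (reindex_inj (inv_inj sK)); apply: eq_bigr => z _.
congr (_ * f _ * _); rewrite ?ffunE ?tpermL //.
- rewrite [RHS](reindex_inj (@perm_inj _ (tperm j k))) /=.
  by apply: eq_bigr => i _; rewrite ffunE.
- rewrite [RHS](reindex_inj (@perm_inj _ (tperm j k))) /=.
  by apply: eq_bigr => i _; rewrite ffunE.
Qed.

Lemma exchangeable_average (f : nat -> R) (j : J) :
  #|J|%:R * (\sum_(z : {ffun J -> bool})
     (\prod_i rho (z i)) * f (\sum_i z i)%N * (z j)%:R)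
  = \sum_(z : {ffun J -> bool})
     (\prod_i rho (z i)) * f (\sum_i z i)%N * (\sum_i z i)%N%:R.
Proof.
rewrite mulr_natl -sumr_const.
rewrite (eq_bigr _ (fun k _ => exchangeable_coordinate f j k)).
by rewrite exchange_big; apply: eq_bigr => z _; rewrite natr_sum mulr_sumr.
Qed.

End Exchangeable.

(** * Events determined by a finite-valued map *)

Section FiniteValued.
Context d (T : measurableType d) (R : realType) (P : probability T R).
Variable Y : finType.

Lemma finite_valued_bigcup (X : T -> Y) (E : pred Y) :
  [set w | E (X w)]
  = \bigcup_(y in [set` [seq y <- enum Y | E y]]) X @^-1` [set y].
Proof.
apply/seteqP; split=> w /=.
  by move=> Ew; exists (X w) => //=; rewrite mem_filter Ew mem_enum.
by move=> [y /=]; rewrite mem_filter => /andP[Ey _] ->.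
Qed.

Lemma measurable_finite_valued (X : T -> Y) (E : pred Y) :
  (forall y, measurable (X @^-1` [set y])) -> measurable [set w | E (X w)].
Proof.
by move=> mX; rewrite finite_valued_bigcup; apply: fin_bigcup_measurable.
Qed.

Lemma probability_finite_valued (X : T -> Y) (E : pred Y) :
  (forall y, measurable (X @^-1` [set y])) ->
  P [set w | E (X w)] = (\sum_(y | E y) fine (P (X @^-1` [set y])))%:E.
Proof.
move=> mX; rewrite finite_valued_bigcup measure_fin_bigcup //; last first.
  by move=> y z _ _ [w [/= -> ->]].
rewrite -fsbig_seq; last by rewrite filter_uniq ?enum_uniq.
rewrite big_filter big_enum_cond /=.
by rewrite -sumEFin; apply: eq_big => // y _; rewrite fineK // fin_num_measure.
Qed.

End FiniteValued.

(** * A weak law of large numbers for finite-valued variables *)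

Section LawOfLargeNumbers.
Context d (T : measurableType d) (R : realType) (P : probability T R).
Variables (Y : finType) (X : nat -> T -> Y).
Hypothesis mX : forall i y, measurable (X i @^-1` [set y]).
Hypothesis indepX : forall n (x : {ffun 'I_n -> Y}),
  fine (P [set w | forall i : 'I_n, X i w = x i])
  = \prod_(i < n) fine (P (X i @^-1` [set x i])).
Variables (g : Y -> R) (mu : R).
Hypothesis g_le1 : forall y, `|g y| <= 1.
Hypothesis g_mean : forall i, \sum_y fine (P (X i @^-1` [set y])) * g y = mu.
Hypothesis mu_neq0 : mu != 0.

(** Outcomes on which [E] differs from [b] lie far from the mean, and Chebyshev's inequality makes
    their mass vanish. *)
Lemma cvg_probability_near_mean (E : forall n, pred {ffun 'I_n -> Y})
    (b : bool) :
  (\forall n \near \oo, forall x : {ffun 'I_n -> Y},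
     `|\sum_(i < n) g (x i) - n%:R * mu| < n%:R * (`|mu| / 2) ->
     E n x = b) ->
  P [set w | E n [ffun i : 'I_n => X i w]] @[n --> \oo] --> (b%:R)%:E.
Proof.
move=> Eb.
pose u i y := fine (P (X i @^-1` [set y])).
have u_ge0 i y : 0 <= u i y by rewrite fine_ge0.
have u_sum1 i : \sum_y u i y = 1.
  have := probability_finite_valued P predT (mX i).
  rewrite (_ : [set w | _] = setT) ?probability_setT; last exact/seteqP.
  by case.
have mXn n (x : {ffun 'I_n -> Y}) :
    measurable ((fun w => [ffun i : 'I_n => X i w]) @^-1` [set x]).
  rewrite (_ : _ @^-1` _ =
    \bigcap_(i in [set: 'I_n]) X i @^-1` [set x i]); last first.
    apply/seteqP; split=> w /=; first by move=> <- i _; rewrite ffunE.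
    by move=> Xx; apply/ffunP => i; rewrite ffunE Xx.
  by apply: fin_bigcap_measurable.
(* Independence moves every probability to the finite product law. *)
have PE n (F : pred {ffun 'I_n -> Y}) :
    P [set w | F [ffun i : 'I_n => X i w]]
    = (\sum_(x : {ffun 'I_n -> Y} | F x) \prod_(i < n) u i (x i))%:E.
  rewrite (probability_finite_valued P F (mXn n)); congr _%:E.
  apply: eq_bigr => x _; rewrite -indepX; congr (fine (P _)).
  apply/seteqP; split=> w /=; first by move=> <- i; rewrite ffunE.
  by move=> Xx; apply/ffunP => i; rewrite ffunE Xx.
apply: cvg_EFin; first by apply: nearW => n; rewrite PE.
apply/cvgrPdist_le => e e_gt0.
have mu_gt0 : 0 < `|mu| by rewrite normr_gt0.
near=> n.
have n_gt0 : 0 < n%:R :> R by near: n; exact: nbhs_infty_gtr.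
have t_gt0 : 0 < n%:R * (`|mu| / 2) by rewrite mulr_gt0 ?divr_gt0.
rewrite /= PE /=.
have total : \sum_(x : {ffun 'I_n -> Y}) \prod_(i < n) u i (x i) = 1.
  by rewrite -(bigA_distr_bigA (fun (i : 'I_n) y => u i y)) big1.
pose far (x : {ffun 'I_n -> Y}) :=
  n%:R * (`|mu| / 2) <= `|\sum_(i < n) g (x i) - n%:R * mu|.
have p_ge0 (x : {ffun 'I_n -> Y}) : 0 <= \prod_(i < n) u i (x i).
  exact: prodr_ge0.
apply: (@le_trans _ _ (\sum_(x | far x) \prod_(i < n) u i (x i))).
  have Efar x : E n x != b -> far x.
    rewrite /far leNgt; apply: contraNN => close.
    by apply/eqP; move: x close; near: n.
  have sub (F : pred {ffun 'I_n -> Y}) : (forall x, F x -> far x) ->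
      \sum_(x | F x) \prod_(i < n) u i (x i)
      <= \sum_(x | far x) \prod_(i < n) u i (x i).
    move=> Ff; rewrite [leLHS]big_mkcond [leRHS]big_mkcond /=.
    by apply: ler_sum => x _; case: ifP => [/Ff ->|_] //; case: ifP.
  (* The distance to the limit is the mass of the outcomes outside [E] if [b] is true, inside [E] if
     it is false. *)
  case: (b) Efar => Efar /=.
    rewrite mulr1n -[X in X - _]total (bigID (E n)) /= addrAC subrr add0r.
    rewrite ger0_norm ?sumr_ge0 //.
    by apply: sub => x /negPf Ex; apply: Efar; rewrite Ex.
  rewrite sub0r normrN ger0_norm ?sumr_ge0 //.
  by apply: sub => x Ex; apply: Efar; rewrite Ex.
have := @product_law_chebyshev R 'I_n Y u u_ge0 u_sum1 g mu g_le1 g_mean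
  _ t_gt0.
rewrite card_ord => /le_trans; apply.
rewrite ler_pdivrMr ?exprn_gt0 //.
(* At distance [n * |mu| / 2] the Chebyshev bound equals [4 / (n * mu ^ 2)]; this [n] makes it at
   most [e]. *)
have n_ge : e^-1 * (4 / `|mu| ^+ 2) <= n%:R by near: n; exact: nbhs_infty_ger.
have {}n_ge : 1 <= e * n%:R * (`|mu| / 2) ^+ 2.
  rewrite [leLHS](_ : 1 =
    e * (e^-1 * (4 / `|mu| ^+ 2)) * (`|mu| / 2) ^+ 2); last first.
    by field; rewrite gt_eqF ?gt_eqF.
  by rewrite ler_wpM2r ?sqr_ge0 // ler_wpM2l // ltW.
have -> : e * (n%:R * (`|mu| / 2)) ^+ 2
          = n%:R * (e * n%:R * (`|mu| / 2) ^+ 2) by ring.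
by rewrite ler_peMr // ltW.
Unshelve. all: by end_near. Qed.

End LawOfLargeNumbers.

(** * The null probability [pbar] and the sign of the mean score *)

Section Score.
Variables (R : realType) (J : nat) (G : R).
Hypothesis J_gt0 : (0 < J)%N.
Hypothesis G_gt0 : 0 < G.

Lemma pbar_den_gt0 m : (m <= J)%N -> 0 < m%:R * G + J%:R - m%:R.
Proof.
move=> mJ; rewrite -addrA -natrB //.
case: m mJ => [|m] mJ; first by rewrite mul0r add0r subn0 ltr0n.
by rewrite ltr_wpDr // mulr_gt0 // ltr0n.
Qed.

Lemma pbar_ge0 m : (m <= J)%N -> 0 <= pbar J G m.
Proof.
by move=> mJ; rewrite divr_ge0 ?mulr_ge0 ?(ltW G_gt0) // ltW // pbar_den_gt0.
Qed.

Lemma pbar_le1 m : (m <= J)%N -> pbar J G m <= 1.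
Proof.
move=> mJ; rewrite ler_pdivrMr ?pbar_den_gt0 // mul1r -addrA lerDl.
by rewrite subr_ge0 ler_nat.
Qed.

Lemma sum_bool_le (z : {ffun 'I_J -> bool}) : (\sum_j z j <= J)%N.
Proof.
by rewrite -[X in (_ <= X)%N]card_ord -sum1_card leq_sum // => j _; case: (z j).
Qed.

End Score.

(* Up to the likelihood ratio of its own law to the common law of the referents,
   the case is exchangeable with them, so its treatment may be replaced by the
   proportion of treated subjects in the set. *)
Lemma mean_score_sign (R : realType) (J : nat) (G r : R) (wt : bool -> R) :
  (0 < J)%N -> 0 < G -> 0 < r < 1 ->
  exists2 K, 0 < K &
    \sum_(z : {ffun 'I_J.+1 -> bool})
      wt (z ord0) * (\prod_(j | j != ord0) if z j then r else 1 - r)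
      * ((z ord0)%:R - pbar J.+1 G (\sum_j z j))
    = K * (wt true * (1 - r) - wt false * r * G).
Proof.
move=> J_gt0 G_gt0 r01.
pose rho (b : bool) : R := if b then r else 1 - r.
pose m (z : {ffun 'I_J.+1 -> bool}) := (\sum_j z j)%N.
have [r_gt0 r_lt1] := andP r01.
have r'_gt0 : 0 < 1 - r by rewrite subr_gt0.
have rho_gt0 b : 0 < rho b by case: b.
have mJ z : (m z <= J.+1)%N := sum_bool_le z.
(* [h k] is [k * (1 - pbar k)], while [(J.+1 - k) * pbar k] is [G * h k]: treated and untreated
   cases contribute multiples of the same quantity. *)
pose h (k : nat) : R := k%:R * (J.+1%:R - k%:R)
                        / (k%:R * G + J.+1%:R - k%:R).
exists (J.+1%:R^-1 * (r * (1 - r))^-1 *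
        \sum_(z : {ffun 'I_J.+1 -> bool}) (\prod_j rho (z j)) * h (m z)).
  rewrite mulr_gt0 ?mulr_gt0 ?invr_gt0 ?mulr_gt0 //.
  have h_ge0 z : 0 <= h (m z).
    rewrite divr_ge0 //; last exact/ltW/pbar_den_gt0.
    by rewrite mulr_ge0 // subr_ge0 ler_nat.
  (* Since [h] vanishes at 0 and at [J.+1], strict positivity needs a configuration with some but
     not all subjects treated. *)
  pose z1 : {ffun 'I_J.+1 -> bool} := [ffun j => j == ord0].
  have mz1 : m z1 = 1%N.
    rewrite /m (bigD1 ord0) //= ffunE eqxx big1 // => j /negPf.
    by rewrite ffunE => ->.
  rewrite (bigD1 z1) //= ltr_wpDr //.
    apply: sumr_ge0 => z _; rewrite mulr_ge0 // prodr_ge0 // => j _.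
    exact: ltW.
  rewrite mulr_gt0 ?prodr_gt0 //.
  rewrite mz1 divr_gt0 //; last exact: pbar_den_gt0.
  by rewrite mulr_gt0 // subr_gt0 ltr1n.
(* Likelihood ratios of the case to a referent. They turn the weight into the exchangeable [rho]
   product, with a score that is affine in [z ord0]. *)
pose al := wt true / r; pose be := wt false / (1 - r).
pose f k := al * (1 - pbar J.+1 G k) + be * pbar J.+1 G k.
have split_score (z : {ffun 'I_J.+1 -> bool}) :
    wt (z ord0) * (\prod_(j | j != ord0) if z j then r else 1 - r)
      * ((z ord0)%:R - pbar J.+1 G (m z))
    = (\prod_j rho (z j)) * f (m z) * (z ord0)%:R
      - (\prod_j rho (z j)) * (be * pbar J.+1 G (m z)).
  rewrite [\prod_j rho (z j)](bigD1 ord0) //= /f /al /be.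
  rewrite -!/(rho _); set pr := \prod_(j | _) _.
  have treated (a b q : R) : a * pr * (1 - q)
      = r * pr * (a / r * (1 - q) + b / (1 - r) * q) * 1
        - r * pr * (b / (1 - r) * q) by field; rewrite !gt_eqF.
  have control (a b q : R) : b * pr * (0 - q)
      = (1 - r) * pr * (a / r * (1 - q) + b / (1 - r) * q) * 0
        - (1 - r) * pr * (b / (1 - r) * q) by field; rewrite !gt_eqF.
  by case: (z ord0); [exact: treated | exact: control].
under eq_bigr do rewrite split_score.
have J0 : J.+1%:R != 0 :> R by rewrite pnatr_eq0.
(* After multiplication by [J.+1], the case's treatment becomes the total [m z]; each term then
   reduces to [(al - be * G) * h (m z)]. *)
have average := exchangeable_average rho f (ord0 : 'I_J.+1).
rewrite card_ord in average.
apply: (mulfI J0); rewrite sumrB mulrBr [X in X - _]average.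
rewrite mulr_sumr -sumrB !mulrA divff // mul1r mulr_sumr mulr_suml.
apply: eq_bigr => z _; rewrite /f /al /be /h /pbar -/(m z).
have := pbar_den_gt0 (ltn0Sn J) G_gt0 (mJ z) => D_gt0.
by move: (J.+1%:R) D_gt0 => Jr D_gt0; field; rewrite !gt_eqF.
Qed.

(** * The joint law of the matched sets *)

Section CaseReferent.
Context d (T : measurableType d) (R : realType) (P : probability T R).
Variables (J : nat) (r : R) (Z N : nat -> nat -> {RV P >-> bool}).

Let Y : finType := ({ffun 'I_J.+1 -> bool} * bool)%type.

(** All that either test reads from a set, as one value of a finite type. *)
Definition matched_set (i : nat) (w : T) : Y :=
  ([ffun j : 'I_J.+1 => Z i j w], N i 0%N w).

(* The event that subject [k] agrees with [x]; [matched_set] does not record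
   the narrow case status of a referent, which is therefore left free. *)
Let slice (x : nat -> Y) (k : nat * nat) : set (bool * bool) :=
  [set (x k.1).1 (inord k.2)] `*`
    (if k.2 == 0%N then [set (x k.1).2] else setT).

Let subj (k : nat * nat) (w : T) := (Z k.1 k.2 w, N k.1 k.2 w).

Lemma matched_set_preimage (x : nat -> Y) (i : nat) :
  matched_set i @^-1` [set x i]
  = \bigcap_(j in [set: 'I_J.+1]) subj (i, val j) @^-1` slice x (i, val j).
Proof.
apply/seteqP; split=> w /=.
  move=> Xx j _; rewrite /slice /= -Xx.
  split=> /=; first by rewrite ffunE inord_val.
  by case: eqP => //= ->.
move=> Xx; rewrite /matched_set [RHS]surjective_pairing; congr pair.
  apply/ffunP => j; rewrite ffunE; have [/= -> _] := Xx j I.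
  by rewrite inord_val.
by have [_ /=] := Xx ord0 I.
Qed.

Lemma measurable_subj (x : nat -> Y) k : measurable (subj k @^-1` slice x k).
Proof.
rewrite (_ : _ @^-1` _ = Z k.1 k.2 @^-1` [set (x k.1).1 (inord k.2)] `&`
  N k.1 k.2 @^-1` (if k.2 == 0%N then [set (x k.1).2] else setT)) //.
by apply: measurableI; apply: measurable_funPTI.
Qed.

Lemma measurable_matched_set i y : measurable (matched_set i @^-1` [set y]).
Proof.
rewrite (matched_set_preimage (fun=> y)).
by apply: fin_bigcap_measurable => // j _; apply: measurable_subj.
Qed.

Hypothesis indep :
  mutually_independent P [set k : nat * nat | (k.2 < J.+1)%N] subj.

(** Independence of the subjects, applied to all subjects of the sets in [s] at once. Singletons [s]
    give the law of one set, intervals the independence of the sets. *)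
Lemma probability_matched_sets (s : seq nat) (x : nat -> Y) : uniq s ->
  fine (P [set w | forall i, i \in s -> matched_set i w = x i])
  = \prod_(i <- s) \prod_(j < J.+1)
      fine (P (subj (i, val j) @^-1` slice x (i, val j))).
Proof.
move=> s_uniq.
(* The subjects are listed without repetition, so that the product over the finite set is a double
   product. *)
pose ks := [seq (i, j) | i <- s, j <- iota 0 J.+1].
have ks_uniq : uniq ks.
  by apply: allpairs_uniq => //; [exact: iota_uniq | case=> ? ? [? ?]].
pose F := seq_fset tt ks.
have -> : [set w | forall i, i \in s -> matched_set i w = x i]
          = \bigcap_(k in [set` F]) subj k @^-1` slice x k.
  apply/seteqP; split=> w /=.
    move=> Xx [i j] /=; rewrite seq_fsetE.
    move=> /allpairsP[[i' j'] [is_ js [-> ->]]].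
    rewrite mem_iota add0n /= in is_ js *.
    have := Xx _ is_ => /= Xi.
    have : (matched_set i' @^-1` [set x i']) w by [].
    by rewrite matched_set_preimage => /(_ (Ordinal js) I).
  move=> Xx i is_; have : (matched_set i @^-1` [set x i]) w; last by [].
  rewrite matched_set_preimage => j _; apply: Xx => /=.
  by rewrite seq_fsetE allpairs_f // mem_iota add0n /=.
rewrite indep; last 2 first.
- move=> [i j] /=; rewrite seq_fsetE => /allpairsP[[i' j'] [_ js [_ ->]]].
  by rewrite mem_iota add0n in js.
- by move=> k; apply: measurableX => //; case: ifP.
rewrite (eq_bigr (fun k => (fine (P (subj k @^-1` slice x k)))%:E)); last first.
  by move=> k _; rewrite fineK // fin_num_measure //; exact: measurable_subj.
rewrite prodEFin /= (perm_big ks); last first.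
  by have := seq_fset_perm tt ks; rewrite undup_id.
rewrite big_allpairs; apply: eq_bigr => i _.
by rewrite -[iota _ _]/(index_iota 0 J.+1) big_mkord.
Qed.

Hypothesis referentP : forall i j b, (0 < j < J.+1)%N ->
  fine (P (Z i j @^-1` [set b])) = if b then r else 1 - r.

Lemma probability_matched_set i (y : Y) :
  fine (P (matched_set i @^-1` [set y]))
  = fine (P [set w | (Z i 0%N w == y.1 ord0) && (N i 0%N w == y.2)])
    * \prod_(j | j != ord0) (if y.1 j then r else 1 - r).
Proof.
have := @probability_matched_sets [:: i] (fun=> y) isT.
rewrite big_seq1 (bigD1 ord0) //=.
have -> : [set w | forall k, k \in [:: i] -> matched_set k w = y]
          = matched_set i @^-1` [set y].
  apply/seteqP; split=> w /=; first by apply; rewrite inE.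
  by move=> Xy k; rewrite inE => /eqP ->.
move=> ->; congr (fine (P _) * _).
  apply/seteqP; split=> w; rewrite /slice /= (_ : inord 0 = ord0).
  - by move=> [-> ->]; rewrite !eqxx.
  - by apply/val_inj; rewrite /= inordK.
  - by move=> /andP[/eqP -> /eqP ->].
  - by apply/val_inj; rewrite /= inordK.
apply: eq_bigr => j j0; rewrite -(@referentP i (val j)).
  congr (fine (P _)); apply/seteqP; split=> w.
    by rewrite /slice /= inord_val => -[].
  rewrite /slice /= inord_val => ->; split=> //=.
  by rewrite ifN.
by rewrite ltn_ord andbT lt0n.
Qed.

(** Both sides expand into the same product over subjects. *)
Lemma indep_matched_sets n (x : {ffun 'I_n -> Y}) :
  fine (P [set w | forall i : 'I_n, matched_set i w = x i])
  = \prod_(i < n) fine (P (matched_set i @^-1` [set x i])).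
Proof.
(* Extends [x] to all naturals; the default value is only taken from [n] on. *)
pose x' i : Y := if insub i is Some k then x k else ([ffun=> false], false).
have x'E (i : 'I_n) : x' i = x i by rewrite /x' valK.
have := @probability_matched_sets (index_iota 0 n) x' (iota_uniq _ _).
rewrite big_mkord (_ : [set w | _] =
  [set w | forall i : 'I_n, matched_set i w = x i]); last first.
  apply/seteqP; split=> w /=.
    by move=> Xx i; rewrite -x'E Xx // mem_index_iota ltn_ord.
  move=> Xx i; rewrite mem_index_iota /= => i_lt.
  by rewrite (Xx (Ordinal i_lt)) -x'E.
move=> ->; apply: eq_bigr => i _.
have := @probability_matched_sets [:: val i] x' isT.
rewrite big_seq1 => <-; congr (fine (P _)); apply/seteqP; split=> w /=.
  by move=> /(_ i); rewrite inE eqxx x'E; apply.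
by move=> Xx k; rewrite inE => /eqP ->; rewrite x'E.
Qed.

End CaseReferent.

(* The deviate [c * Num.sqrt V] is of order [Num.sqrt n], hence negligible
   against the drift [n * mu]. *)
Lemma threshold_near_mean (R : realType) (c mu : R) : mu != 0 ->
  \forall n \near \oo, forall S V : R, 0 <= V <= n%:R ->
    `|S - n%:R * mu| < n%:R * (`|mu| / 2) -> (c * Num.sqrt V <= S) = (0 < mu).
Proof.
move=> mu0; have mu_gt0 : 0 < `|mu| by rewrite normr_gt0.
near=> n => S V /andP[V0 Vn]; set h := n%:R * (`|mu| / 2) => close.
have h_ge0 : 0 <= h by rewrite mulr_ge0 ?divr_ge0.
have dev_le : `|c * Num.sqrt V| <= h.
  (* Chosen so that [|c| * sqrt n] is at most half the drift, [n * |mu| / 2]. *)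
  have n_ge : (2 * `|c| / `|mu|) ^+ 2 <= n%:R by near: n; exact: nbhs_infty_ger.
  have c_le : 2 * `|c| / `|mu| <= Num.sqrt n%:R.
    by rewrite -[leLHS]ger0_norm ?divr_ge0 ?mulr_ge0 // -sqrtr_sqr ler_wsqrtr.
  rewrite normrM (ger0_norm (sqrtr_ge0 _)).
  apply: (@le_trans _ _ (`|c| * Num.sqrt n%:R)).
    by rewrite ler_wpM2l // ler_wsqrtr.
  rewrite /h -[X in X * (_ / _)](@sqr_sqrtr _ n%:R) // expr2 -mulrA mulrC.
  rewrite ler_wpM2l ?sqrtr_ge0 //.
  have -> : `|c| = 2 * `|c| / `|mu| * (`|mu| / 2) by field; rewrite gt_eqF.
  by rewrite ler_wpM2r ?divr_ge0.
have h2 : h + h = n%:R * `|mu| by rewrite /h; field.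
move: dev_le close; rewrite ler_norml ltr_norml => /andP[d1 d2] /andP[s1 s2].
(* [S] lies below [- h] or above [h] according to the sign of [mu], and the deviate lies between
   these bounds. *)
case: (ltrgtP mu 0) mu0 h2 => // mu_sgn _.
  rewrite ltr0_norm // mulrN => h2; apply/negbTE; rewrite -ltNge.
  by apply: lt_le_trans d1; move: s2; lra.
rewrite gtr0_norm // => h2.
by apply: le_trans d2 _; move: s1; lra.
Unshelve. all: by end_near. Qed.

(** * The limiting power of a test *)

Section TestPower.
Context d (T : measurableType d) (R : realType) (P : probability T R).
Variables (J : nat) (r : R) (Z N : nat -> nat -> {RV P >-> bool}).
Hypothesis J_gt0 : (0 < J)%N.
Hypothesis r01 : 0 < r < 1.
Hypothesis indep : mutually_independent P [set k : nat * nat | (k.2 < J.+1)%N]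
  (fun k w => (Z k.1 k.2 w, N k.1 k.2 w)).
Hypothesis referentP : forall i j b, (0 < j < J.+1)%N ->
  fine (P (Z i j @^-1` [set b])) = if b then r else 1 - r.
Variables (A : pred bool) (wt : bool -> R).
Hypothesis caseP : forall i b,
  fine (P [set w | (Z i 0%N w == b) && A (N i 0%N w)]) = wt b.

(** Sums out the narrow case status, which enters the score only through [A]. *)
Lemma case_weight i b :
  \sum_n fine (P [set w | (Z i 0%N w == b) && (N i 0%N w == n)]) * (A n)%:R
  = wt b.
Proof.
have mN n : measurable (N i 0%N @^-1` [set n]) by apply: measurable_funPTI.
pose X w := (Z i 0%N w, N i 0%N w).
have mX y : measurable (X @^-1` [set y]).
  rewrite (_ : _ @^-1` _ = Z i 0%N @^-1` [set y.1] `&` N i 0%N @^-1` [set y.2]).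
    by apply: measurableI; apply: measurable_funPTI.
  by case: y => a n; apply/seteqP; split=> w /=; [case=> -> -> | case=> <- <-].
pose E (y : bool * bool) := (y.1 == b) && A y.2.
rewrite -(caseP i) (probability_finite_valued P E mX) /=.
rewrite (eq_bigr (fun y => fine (P (X @^-1` [set (y.1, y.2)])))); last by case.
rewrite -(pair_big_dep (pred1 b) (fun=> A)
  (fun z n => fine (P (X @^-1` [set (z, n)])))) /=.
rewrite big_pred1_eq [RHS]big_mkcond /=; apply: eq_bigr => n _.
case: (A n); rewrite ?mulr0 // mulr1; congr (fine (P _)).
apply/seteqP; split=> w /=; first by move=> /andP[/eqP <- /eqP <-].
by case=> <- <-; rewrite !eqxx.
Qed.

Lemma test_power_limit (alpha G : R) : 0 < G ->
  wt true * (1 - r) - wt false * r * G != 0 ->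
  P [set w | test_rejects J.+1 alpha G n (fun i => A (N i 0%N w))
               (fun i j => Z i j w)] @[n --> \oo]
  --> ((0 < wt true * (1 - r) - wt false * r * G)%R%:R)%:E.
Proof.
move=> G_gt0; set delta := _ - _ => delta_neq0.
pose Y : finType := ({ffun 'I_J.+1 -> bool} * bool)%type.
pose m (y : Y) := (\sum_j y.1 j)%N.
have mJ y : (m y <= J.+1)%N := sum_bool_le y.1.
pose p (y : Y) := pbar J.+1 G (m y).
have p_ge0 y : 0 <= p y by apply: pbar_ge0.
have p_le1 y : p y <= 1 by apply: pbar_le1.
pose g (y : Y) : R := (A y.2)%:R * ((y.1 ord0)%:R - p y).
have g_le1 y : `|g y| <= 1.
  rewrite /g; case: (A y.2); rewrite ?mul0r ?normr0 // mul1r ler_norml.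
  have := p_ge0 y; have := p_le1 y.
  by case: (y.1 ord0) => /=; rewrite ?mulr1n ?mulr0n => ? ?; apply/andP;
    split; lra.
have [K K_gt0 KE] := mean_score_sign wt J_gt0 G_gt0 r01.
have g_mean i :
    \sum_y fine (P (matched_set J Z N i @^-1` [set y])) * g y = K * delta.
  rewrite -KE; pose F z n :=
    fine (P (matched_set J Z N i @^-1` [set (z, n)])) * g (z, n).
  rewrite (eq_bigr (fun y => F y.1 y.2)); last by case.
  rewrite -(pair_bigA _ F) /F /=.
  apply: eq_bigr => z _; rewrite -(case_weight i) -mulrA mulr_suml.
  apply: eq_bigr => n _; rewrite (probability_matched_set indep referentP) /=.
  rewrite /g /p /m /= !mulrA; congr (_ * _); rewrite -!mulrA; congr (_ * _).
  by rewrite mulrC.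
have mu_neq0 : K * delta != 0 by rewrite mulf_neq0 // gt_eqF.
(* The rejection inequality with the [pbar] sum moved to the side of the treated cases. *)
pose E n (x : {ffun 'I_n -> Y}) :=
  Phi_inv (1 - alpha)
    * Num.sqrt (\sum_(i < n | A (x i).2) p (x i) * (1 - p (x i)))
  <= \sum_(i < n) g (x i).
have -> : (fun n => P [set w | test_rejects J.+1 alpha G n
      (fun i => A (N i 0%N w)) (fun i j => Z i j w)])
    = (fun n => P [set w | E n [ffun i : 'I_n => matched_set J Z N i w]]).
  apply/funext => n; congr (P _); apply/seteqP.
  suff EE w : test_rejects J.+1 alpha G n
      (fun i => A (N i 0%N w)) (fun i j => Z i j w)
      = (E n [ffun i : 'I_n => matched_set J Z N i w] : Prop).
    by split=> w /=; rewrite EE.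
  have pE i : p (matched_set J Z N i w)
              = pbar J.+1 G (nb_treated J.+1 (fun i j => Z i j w) i).
    rewrite /p /m /nb_treated /=; congr pbar; apply: eq_bigr => j _.
    by rewrite ffunE.
  rewrite /test_rejects /E addrC -lerBrDr -sumrB; congr (is_true (_ <= _)).
    congr (_ * Num.sqrt _); apply: eq_big => [i|i _]; first by rewrite ffunE.
    by rewrite ffunE pE.
  rewrite big_mkcond; apply: eq_bigr => i _; rewrite /g ffunE pE /= ffunE.
  by case: ifP; rewrite ?mul1r ?mul0r.
(* The sign of [delta] is that of the mean score [K * delta]. *)
rewrite -(pmulr_rgt0 _ K_gt0).
apply: (cvg_probability_near_mean (measurable_matched_set Z N)
  (indep_matched_sets indep) g_le1 g_mean mu_neq0).
near=> n => x close.
apply: (near (threshold_near_mean (Phi_inv (1 - alpha)) mu_neq0) n) close => //.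
apply/andP; split.
  by apply: sumr_ge0 => i _; rewrite mulr_ge0 // subr_ge0.
(* The variance term is at most [n], each summand being at most 1. *)
rewrite big_mkcond /= -[X in _ <= X%:R]card_ord -sum1_card natr_sum.
apply: ler_sum => i _; case: ifP => // _.
by rewrite mulr_ile1 // ?subr_ge0 // gerBl.
Unshelve. all: by end_near. Qed.

End TestPower.

(** * Complements and posterior probabilities *)

Lemma fine_probability_false d (T : measurableType d) (R : realType)
    (P : probability T R) (X : {RV P >-> bool}) :
  fine (P [set w | ~~ X w]) = 1 - fine (P [set w | X w]).
Proof.
have mX : measurable [set w | X w].
  rewrite (_ : [set w | X w] = X @^-1` [set true]) //.
  exact: measurable_funPTI.
rewrite (_ : [set w | ~~ X w] = ~` [set w | X w]); last first.
  by apply/seteqP; split=> w /=; move/negP.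
by rewrite probability_setC // fineB // fin_num_measure.
Qed.

(** The fraction is Bayes' formula with prior [p]; it covers the treatment probabilities of cases
    and of referents. *)
Lemma posterior_itv (R : realType) (a b p : R) :
  0 < a -> 0 < b -> 0 < p < 1 -> 0 < a * p / (a * p + b * (1 - p)) < 1.
Proof.
move=> a0 b0 /andP[p0 p1].
have D0 : 0 < a * p + b * (1 - p) by rewrite addr_gt0 ?mulr_gt0 ?subr_gt0.
rewrite divr_gt0 ?mulr_gt0 //= ltr_pdivrMr // mul1r ltrDl.
by rewrite mulr_gt0 // subr_gt0.
Qed.

(** * From the sign of the mean score to the design sensitivity *)

Section CaseReferentDesign.
Context d (T : measurableType d) (R : realType) (P : probability T R).
Variables (J : nat) (alpha p bT bC etaT etaC : R).
Variables (Z N : nat -> nat -> {RV P >-> bool}).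
Hypothesis J_gt1 : (1 < J)%N.
Hypotheses (p01 : 0 < p < 1) (bT01 : 0 < bT < 1) (bC01 : 0 < bC < 1).
Hypothesis process : case_referent_process J p bT bC etaT etaC Z N.

Let q := bT * p / (bT * p + bC * (1 - p)).
Let r := (1 - bT) * p / ((1 - bT) * p + (1 - bC) * (1 - p)).

(* [A] selects the sets that the test uses: all of them for the broad case
   test, those with a narrow case for the narrow case test. *)
Lemma design_sensitivity_test (A : pred bool) (eT eC Theta : R) :
  0 < eT -> 0 < eC -> 0 < Theta ->
  (forall i, fine (P [set w | Z i 0%N w && A (N i 0%N w)]) = q * eT) ->
  (forall i, fine (P [set w | ~~ Z i 0%N w && A (N i 0%N w)]) = (1 - q) * eC) ->
  design_sensitivity
    (fun Gamma I => P [set w | test_rejects J alpha (Theta * Gamma) I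
       (fun i => A (N i 0%N w)) (fun i j => Z i j w)])
    (bT / (1 - bT) / (bC / (1 - bC)) * (eT / eC / Theta)).
Proof.
move=> eT0 eC0 Th0 treatedP controlP.
have [bT0 bT1] := andP bT01; have [bC0 bC1] := andP bC01.
have [p0 p1] := andP p01.
have bT'0 : 0 < 1 - bT by rewrite subr_gt0.
have bC'0 : 0 < 1 - bC by rewrite subr_gt0.
have p'0 : 0 < 1 - p by rewrite subr_gt0.
have r01 : 0 < r < 1 by apply: posterior_itv.
(* [K] counts the referents; at least one is required for a positive multiple in the mean score. *)
have [K J_gt0 JK] : exists2 K, (0 < K)%N & J = K.+1.
  by case: (J) J_gt1 => // K; exists K.
move: process; rewrite JK => -[indep _ referentP _ _ _].
have referent_weight i j b : (0 < j < K.+1)%N ->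
    fine (P (Z i j @^-1` [set b])) = if b then r else 1 - r.
  move=> ij; have Zij := referentP i j ij; case: b.
    by rewrite (_ : _ @^-1` _ = [set w | Z i j w]) // Zij.
  rewrite (_ : _ @^-1` _ = [set w | ~~ Z i j w]).
    by rewrite fine_probability_false Zij.
  by apply/seteqP; split=> w /=; [move=> -> | move/negbTE].
pose wt (b : bool) := if b then q * eT else (1 - q) * eC.
have caseP i b : fine (P [set w | (Z i 0%N w == b) && A (N i 0%N w)]) = wt b.
  case: b; rewrite /wt -?(treatedP i) -?(controlP i); congr (fine (P _)).
    by apply/seteqP; split=> w /=; rewrite eqb_id.
  by apply/seteqP; split=> w /=; rewrite eqbF_neg.
set Gamma0 := _ * (_ / Theta) => Gamma Gamma_ge1.
have Gamma_gt0 : 0 < Gamma by apply: lt_le_trans Gamma_ge1.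
pose delta := wt true * (1 - r) - wt false * r * (Theta * Gamma).
have [C C0 deltaE] : exists2 C, 0 < C & delta = C * (Gamma0 - Gamma).
  have Dq : 0 < bT * p + bC * (1 - p) by rewrite addr_gt0 ?mulr_gt0.
  have Dr : 0 < (1 - bT) * p + (1 - bC) * (1 - p) by rewrite addr_gt0 ?mulr_gt0.
  (* The coefficient of [- Gamma] in [delta], once [q] and [r] are written out; [Gamma0] is the
     root. *)
  exists (p * (1 - p) * bC * (1 - bT) * eC * Theta /
    ((bT * p + bC * (1 - p)) * ((1 - bT) * p + (1 - bC) * (1 - p)))).
    by rewrite divr_gt0 ?mulr_gt0.
  by rewrite /delta /wt /Gamma0 /q /r; field; rewrite !gt_eqF.
have powerP := @test_power_limit _ _ _ _ _ _ _ _ J_gt0 r01 indep referent_weight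
  A wt caseP alpha (Theta * Gamma) (mulr_gt0 Th0 Gamma_gt0).
rewrite -/delta in powerP.
split=> GG.
  have delta_gt0 : 0 < delta by rewrite deltaE mulr_gt0 // subr_gt0.
  by move: powerP; rewrite delta_gt0; apply; rewrite gt_eqF.
have delta_lt0 : delta < 0 by rewrite deltaE pmulr_rlt0 // subr_lt0.
by move: powerP; rewrite lt_gtF //= ltr0_neq0 // => /(_ isT).
Qed.

End CaseReferentDesign.

(** * The broad case and narrow case tests *)

Theorem mainTheorem3 (R : realType) (d : measure_display)
    (T : measurableType d) (P : probability T R)
    (J : nat) (alpha Theta p bT bC etaT etaC : R)
    (Z N : nat -> nat -> {RV P >-> bool}) :
  (2 <= J)%N ->
  0 < alpha < 1 ->
  1 <= Theta ->
  0 < p < 1 -> 0 < bT < 1 -> 0 < bC < 1 ->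
  0 < etaT <= 1 -> 0 < etaC <= 1 ->
  case_referent_process J p bT bC etaT etaC Z N ->
  design_sensitivity
    (fun Gamma I =>
       P [set w | broad_test_rejects J alpha Gamma I (fun i j => Z i j w)])
    ((bT / (1 - bT)) / (bC / (1 - bC))) /\
  design_sensitivity
    (fun Gamma I =>
       P [set w | narrow_test_rejects J alpha Theta Gamma I
                    (fun i j => Z i j w) (fun i j => N i j w)])
    ((bT / (1 - bT)) / (bC / (1 - bC)) * (etaT / etaC / Theta)).
Proof.
move=> J_gt1 _ Theta_ge1 p01 bT01 bC01 /andP[etaT0 _] /andP[etaC0 _] process.
have [_ caseZ _ treatedN controlN _] := process.
have /andP[q_gt0 q_lt1] : 0 < bT * p / (bT * p + bC * (1 - p)) < 1.
  by apply: posterior_itv p01; [case/andP: bT01 | case/andP: bC01].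
have Zq i : fine (P [set w | Z i 0%N w]) = bT * p / (bT * p + bC * (1 - p)).
  by rewrite caseZ.
split.
  move=> Gamma Gamma_ge1.
  (* Every set is used, so the selection probabilities and [Theta] are all 1 and the second factor
     disappears. *)
  have := @design_sensitivity_test _ _ _ P J alpha p bT bC etaT etaC Z N J_gt1
    p01 bT01 bC01 process xpredT 1 1 1 ltr01 ltr01 ltr01.
  rewrite !divr1 !mulr1 => sens.
  have {}sens := sens _ _ Gamma Gamma_ge1.
  rewrite mul1r in sens; apply: sens => i.
    rewrite -(Zq i); congr (fine (P _)).
    by apply/seteqP; split=> w /=; rewrite andbT.
  rewrite -(Zq i) -fine_probability_false; congr (fine (P _)).
  by apply/seteqP; split=> w /=; rewrite andbT.
apply: (@design_sensitivity_test _ _ _ P J alpha p bT bC etaT etaC Z N J_gt1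
  p01 bT01 bC01 process id) => //.
- exact: lt_le_trans Theta_ge1.
(* The joint probability of treatment and narrow case status is recovered from the conditional one,
   as [q] is positive. *)
- move=> i; rewrite -(treatedN i) /cond_prob Zq mulrC divfK ?gt_eqF //.
  by congr (fine (P _)); apply/seteqP; split=> w /=;
    [move=> /andP[] | move=> [? ?]; apply/andP].
move=> i; rewrite -(controlN i) /cond_prob fine_probability_false Zq.
rewrite mulrC divfK ?gt_eqF ?subr_gt0 //.
by congr (fine (P _)); apply/seteqP; split=> w /=;
    [move=> /andP[] | move=> [? ?]; apply/andP].
Qed.
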